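(* Consider the iterative averaging method described in the context, in the noisy case $Y_i=X_i\beta+\varepsilon_i$, $i=1,\dots,k$. 1. If at least one $X_i^\top X_i$ has strictly positive eigenvalues, then the iterates $\hat\beta^t$ converge as $t\to\infty$ to the limiting unbiased (for $\beta$) estimator $$\hat\beta_*=\left(\sum_{i=1}^k(X_i^\top X_i+n_i\rho_iI)^{-1}X_i^\top X_i\right)^{-1}\sum_{i=1}^k(X_i^\top X_i+n_i\rho_iI)^{-1}X_i^\top Y_i,$$ and the convergence is geometric: $$\|\hat\beta^t-\hat\beta_*\|_2\le\lambda_{\max}\left(\frac1k\sum_{i=1}^kn_i\rho_i(X_i^\top X_i+n_i\rho_iI)^{-1}\right)^t\|\hat\beta_*\|_2.$$ 2. The mean squared error of $\hat\beta_*$ is $$\mathbb{E}\|\hat\beta_*-\beta\|^2=\sigma^2\sum_{i=1}^k\operatorname{tr}\left[\left(\sum_{j=1}^k(X_j^\top X_j+n_j\rho_jI)^{-1}X_j^\top X_j\right)^{-2}(X_i^\top X_i+n_i\rho_iI)^{-2}X_i^\top X_i\right].$$ For items 3-5, suppose that the samples are evenly distributed, $n_1=\dots=n_k=n/k$, and that $\rho_1=\dots=\rho_k=\rho$; let $\psi(\rho)=\mathbb{E}\|\hat\beta_*-\beta\|^2$ denote the MSE as a function of $\rho\in[0,\infty)$. 3. $\psi$ is differentiable on $[0,\infty)$, with derivative $$\psi'(\rho)=\frac{2k\sigma^2}{n}\operatorname{tr}\left[\Delta^{-1}\sum_{i=1}^k(\hat\Sigma_i+\rho I)^{-2}\hat\Sigma_i\cdot\Delta^{-2}\sum_{i=1}^k(\hat\Sigma_i+\rho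 I)^{-2}\hat\Sigma_i-\Delta^{-2}\sum_{i=1}^k(\hat\Sigma_i+\rho I)^{-3}\hat\Sigma_i\right],$$ where $\hat\Sigma_i=X_i^\top X_i/n_i$ and $\Delta=\sum_{i=1}^k(\hat\Sigma_i+\rho I)^{-1}\hat\Sigma_i$. 4. $\psi$ is a non-increasing function on $[0,\infty)$ and $\psi'(0)<0$. So for any $\rho>0$, $\psi(\rho)<\psi(0)$; i.e. the MSE of the iterative averaging estimator with positive regularizer is smaller than the MSE of the one-step averaging estimator. 5. When $\rho=0$, $\hat\beta_*$ reduces to the one-step averaging estimator $\frac1k\sum_{i=1}^k(X_i^\top X_i)^{-1}X_i^\top Y_i$, with MSE $$\psi(0)=\frac{\sigma^2}{k^2}\sum_{i=1}^k\operatorname{tr}(X_i^\top X_i)^{-1}.$$ When $\rho\to+\infty$, $\hat\beta_*$ converges to the OLS estimator $(X^\top X)^{-1}X^\top Y$, with MSE $$\lim_{\rho\to+\infty}\psi(\rho)=\sigma^2\operatorname{tr}(X^\top X)^{-1}.$$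
   Context: Setting. $X$ ($n\times p$, fixed) and $Y$ ($n\times1$) are partitioned by rows into $X_1,\dots,X_k$ and $Y_1,\dots,Y_k$, where $X_i$ is $n_i\times p$ and $n=\sum_in_i$. The model is $Y=X\beta+\varepsilon$, with $\beta\in\mathbb{R}^p$ unknown and fixed, where the coordinates of the noise $\varepsilon$ (partitioned into $\varepsilon_1,\dots,\varepsilon_k$) have mean zero, are uncorrelated, and have variance $\sigma^2>0$. The local ordinary least squares estimators $(X_i^\top X_i)^{-1}X_i^\top Y_i$ are assumed well defined (all $X_i^\top X_i$ invertible) in items 3-5. Iterative averaging method. Given regularization parameters $\rho_i\ge0$ such that all matrices $X_i^\top X_i+n_i\rho_iI$ are invertible, set $\hat\beta^0=0$ and for $t\ge0$ $$\hat\beta_i^{t+1}=(X_i^\top X_i+n_i\rho_iI)^{-1}(X_i^\top Y_i+n_i\rho_i\hat\beta^t),\qquad \hat\beta^{t+1}=\frac1k\sum_{i=1}^k\hat\beta_i^{t+1}.$$ In item 2, the condition of item 1 is in force so that $\hat\beta_*$ is defined. $\lambda_{\max}$ denotes the largest eigenvalue.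
   Formalization: In item 4 the claims ψ'(0)<0 and ψ(ρ)<ψ(0) for ρ>0 (with the MSE comparison) are stated only when the X_i^T X_i are not all equal; if they all coincide (e.g. k=1), ψ is constant and these claims fail. *)

(* Defs.v *)
From HB Require Import structures.
From mathcomp Require Import all_boot all_order all_algebra.
From mathcomp Require Import all_classical all_reals all_analysis.

Set Implicit Arguments.
Unset Strict Implicit.
Unset Printing Implicit Defensive.

Import Order.TTheory GRing.Theory Num.Theory.
Import numFieldNormedType.Exports.

Local Open Scope classical_set_scope.
Local Open Scope ring_scope.

(* The library norm on matrices is the maximum norm, hence this definition. *)
Definition norm2 (R : realType) (p : nat) (v : 'cV[R]_p) : R :=
  Num.sqrt (\sum_(i < p) v i 0 ^+ 2).

(* Only applied to symmetric matrices of positive size, whose spectrum is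
   finite and nonempty, so that the supremum is a maximum. *)
Definition lambda_max (R : realType) (p : nat) (A : 'M[R]_p) : R :=
  sup [set a | eigenvalue A a].

(* Differentiation relative to a domain: the difference quotient at [x] is
   only taken at points of [D], so it is one-sided at an endpoint. *)
Definition diff_quot (R : realType) (f : R -> R) (x y : R) : R :=
  (f y - f x) / (y - x).

Definition derivable_within (R : realType) (D : set R) (f : R -> R) (x : R)
    : Prop :=
  cvg (diff_quot f x @ within D x^').

Definition derive_within (R : realType) (D : set R) (f : R -> R) (x : R) : R :=
  lim (diff_quot f x @ within D x^').

(* [nn i] is the number of rows n_i of the i-th block, and the number of rows
   of X and Y is n = \sum_i nn i; the i-th block is [submxcol _ i]. *)

Definition gram (R : realType) (k p : nat) (nn : 'I_k -> nat)
    (X : 'M[R]_(\sum_i nn i, p)) (i : 'I_k) : 'M[R]_p :=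
  (submxcol X i)^T *m submxcol X i.

Definition xty (R : realType) (k p : nat) (nn : 'I_k -> nat)
    (X : 'M[R]_(\sum_i nn i, p)) (Y : 'cV[R]_(\sum_i nn i)) (i : 'I_k) :
    'cV[R]_p :=
  (submxcol X i)^T *m submxcol Y i.

Definition reg_gram (R : realType) (k p : nat) (nn : 'I_k -> nat)
    (X : 'M[R]_(\sum_i nn i, p)) (rho : 'I_k -> R) (i : 'I_k) : 'M[R]_p :=
  gram X i + ((nn i)%:R * rho i)%:M.

Definition admissible (R : realType) (k p : nat) (nn : 'I_k -> nat)
    (X : 'M[R]_(\sum_i nn i, p)) (rho : 'I_k -> R) : Prop :=
  forall i, 0 <= rho i /\ reg_gram X rho i \in unitmx.

Definition local_update (R : realType) (k p : nat) (nn : 'I_k -> nat)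
    (X : 'M[R]_(\sum_i nn i, p)) (Y : 'cV[R]_(\sum_i nn i)) (rho : 'I_k -> R)
    (b : 'cV[R]_p) (i : 'I_k) : 'cV[R]_p :=
  invmx (reg_gram X rho i) *m (xty X Y i + ((nn i)%:R * rho i) *: b).

Fixpoint beta_iter (R : realType) (k p : nat) (nn : 'I_k -> nat)
    (X : 'M[R]_(\sum_i nn i, p)) (Y : 'cV[R]_(\sum_i nn i)) (rho : 'I_k -> R)
    (t : nat) : 'cV[R]_p :=
  if t is s.+1 then
    k%:R^-1 *: \sum_(i < k) local_update X Y rho (beta_iter X Y rho s) i
  else 0.

Definition weight_mx (R : realType) (k p : nat) (nn : 'I_k -> nat)
    (X : 'M[R]_(\sum_i nn i, p)) (rho : 'I_k -> R) : 'M[R]_p :=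
  \sum_(i < k) invmx (reg_gram X rho i) *m gram X i.

Definition beta_star (R : realType) (k p : nat) (nn : 'I_k -> nat)
    (X : 'M[R]_(\sum_i nn i, p)) (rho : 'I_k -> R)
    (Y : 'cV[R]_(\sum_i nn i)) : 'cV[R]_p :=
  invmx (weight_mx X rho) *m
  \sum_(i < k) invmx (reg_gram X rho i) *m xty X Y i.

Definition contraction_mx (R : realType) (k p : nat) (nn : 'I_k -> nat)
    (X : 'M[R]_(\sum_i nn i, p)) (rho : 'I_k -> R) : 'M[R]_p :=
  k%:R^-1 *:
  \sum_(i < k) ((nn i)%:R * rho i) *: invmx (reg_gram X rho i).

Definition one_step (R : realType) (k p : nat) (nn : 'I_k -> nat)
    (X : 'M[R]_(\sum_i nn i, p)) (Y : 'cV[R]_(\sum_i nn i)) : 'cV[R]_p :=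
  k%:R^-1 *: \sum_(i < k) invmx (gram X i) *m xty X Y i.

Definition ols (R : realType) (n p : nat) (X : 'M[R]_(n, p)) (Y : 'cV[R]_n) :
    'cV[R]_p :=
  invmx (X^T *m X) *m (X^T *m Y).

Definition white_noise (d : measure_display) (T : measurableType d)
    (R : realType) (P : probability T R) (n : nat)
    (eps : 'I_n -> {RV P >-> R}) (sigma : R) : Prop :=
  [/\ forall j, (eps j : T -> R) \in Lfun P 2%:E,
      forall j, ('E_P[eps j] = 0)%E,
      forall j, ('V_P[eps j] = (sigma ^+ 2)%R%:E)%E &
      forall j l, j != l -> covariance P (eps j) (eps l) = 0%E].

Definition observation (d : measure_display) (T : measurableType d)
    (R : realType) (P : probability T R) (n p : nat) (X : 'M[R]_(n, p))
    (beta : 'cV[R]_p) (eps : 'I_n -> {RV P >-> R}) (w : T) : 'cV[R]_n :=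
  X *m beta + \col_j eps j w.

Definition mse (d : measure_display) (T : measurableType d) (R : realType)
    (P : probability T R) (p : nat) (est : T -> 'cV[R]_p) (beta : 'cV[R]_p) :
    \bar R :=
  'E_P[fun w => (norm2 (est w - beta) ^+ 2)%R]%E.

Definition psi (d : measure_display) (T : measurableType d) (R : realType)
    (P : probability T R) (k p : nat) (nn : 'I_k -> nat)
    (X : 'M[R]_(\sum_i nn i, p)) (beta : 'cV[R]_p)
    (eps : 'I_(\sum_i nn i) -> {RV P >-> R}) (rho : R) : R :=
  fine (mse P (fun w => beta_star X (fun=> rho) (observation X beta eps w))
    beta).

Definition hat_Sigma (R : realType) (k p : nat) (nn : 'I_k -> nat)
    (X : 'M[R]_(\sum_i nn i, p)) (i : 'I_k) : 'M[R]_p :=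
  (nn i)%:R^-1 *: gram X i.

(* \sum_i (hat_Sigma_i + rho I)^-m hat_Sigma_i *)
Definition resolvent_sum (R : realType) (k p : nat) (nn : 'I_k -> nat)
    (X : 'M[R]_(\sum_i nn i, p)) (rho : R) (m : nat) : 'M[R]_p :=
  \sum_(i < k) invmx (hat_Sigma X i + rho%:M) ^+ m *m hat_Sigma X i.

(* Main.v *)
Require Import Defs.
From HB Require Import structures.
From mathcomp Require Import all_boot all_order all_algebra.
From mathcomp Require Import all_classical all_reals all_analysis.
From mathcomp Require Import ring lra.

(* Write G_i for the regularized Gram matrices and W = sum_i G_i^-1 X_i^T X_i,
   which is positive definite.  The error of the iterates is multiplied at each
   step by I - W / k, a symmetric matrix with spectrum in [0, 1), whence the
   geometric convergence.  The limit is beta + H eps for an explicit matrix H,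
   so its mean squared error is sigma^2 tr (H H^T).

   In the balanced case let R_i = (S_i + rho I)^-1, D = sum_i R_i S_i,
   B = sum_i R_i^2 S_i and C = sum_i R_i^3 S_i, where the S_i are the normalized
   Gram matrices.  Then psi is proportional to tr (D^-2 B), and D' = - B,
   B' = - 2 C give psi' proportional to - tr (D^-1 (C - B D^-1 B) D^-1).  With
   Q = D^-1 B, the Schur complement C - B D^-1 B is the sum of the positive
   semidefinite matrices (R_i - Q)^T R_i S_i (R_i - Q); it vanishes only if all
   the R_i, hence all the S_i, are equal.  The limit at infinity follows from
   rho R_i --> I. *)

Set Implicit Arguments.
Unset Strict Implicit.
Unset Printing Implicit Defensive.

Import Order.TTheory GRing.Theory Num.Theory.
Import numFieldNormedType.Exports.

Local Open Scope classical_set_scope.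
Local Open Scope ring_scope.

(** * Positive semidefinite matrices *)

Lemma unitmx_ker (F : fieldType) (p : nat) (A : 'M[F]_p) :
  (forall v : 'cV_p, A *m v = 0 -> v = 0) -> A \in unitmx.
Proof.
move=> kerA; rewrite -unitmx_tr -row_free_unit -kermx_eq0.
apply/eqP/row_matrixP => i; rewrite row0; apply: trmx_inj; rewrite trmx0.
apply: kerA; apply: trmx_inj.
by rewrite trmx_mul trmxK trmx0 -row_mul mulmx_ker row0.
Qed.

Definition quad (R : pzRingType) (p : nat) (A : 'M[R]_p) (u v : 'cV[R]_p) : R :=
  (u^T *m A *m v) 0 0.

(** Symmetry is part of the notion: over the reals the quadratic form does not see the antisymmetric
    part. *)
Definition psd (R : numDomainType) (p : nat) (A : 'M[R]_p) : Prop :=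
  A^T = A /\ forall v, 0 <= quad A v v.

(** Strict positivity is encoded as invertibility, the form in which the hypotheses on Gram matrices
    are given; [pd_quad_gt0] recovers the strict inequality. *)
Definition pd (R : numFieldType) (p : nat) (A : 'M[R]_p) : Prop :=
  psd A /\ A \in unitmx.

Section Quad.
Variables (R : realFieldType) (p : nat).
Implicit Types (A B : 'M[R]_p) (u v w : 'cV[R]_p) (c : R).

Lemma quadDm A B u v : quad (A + B) u v = quad A u v + quad B u v.
Proof. by rewrite /quad mulmxDr mulmxDl mxE. Qed.

Lemma quadNm A u v : quad (- A) u v = - quad A u v.
Proof. by rewrite /quad mulmxN mulNmx mxE. Qed.

Lemma quadZm c A u v : quad (c *: A) u v = c * quad A u v.
Proof. by rewrite /quad -scalemxAr -scalemxAl mxE. Qed.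

Lemma quadDl A u v w : quad A (u + v) w = quad A u w + quad A v w.
Proof. by rewrite /quad linearD /= !mulmxDl mxE. Qed.

Lemma quadDr A u v w : quad A u (v + w) = quad A u v + quad A u w.
Proof. by rewrite /quad mulmxDr mxE. Qed.

Lemma quadZl A c u v : quad A (c *: u) v = c * quad A u v.
Proof. by rewrite /quad linearZ /= -!scalemxAl mxE. Qed.

Lemma quadZr A c u v : quad A u (c *: v) = c * quad A u v.
Proof. by rewrite /quad -!scalemxAr mxE. Qed.

Lemma quadC A u v : A^T = A -> quad A u v = quad A v u.
Proof.
move=> symA; rewrite /quad; transitivity ((u^T *m A *m v)^T 0 0).
  by rewrite [RHS]mxE.
by rewrite !trmx_mul trmxK symA mulmxA.
Qed.

Lemma quad_mulr A B u v : quad A u (B *m v) = quad (A *m B) u v.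
Proof. by rewrite /quad !mulmxA. Qed.

Lemma quad_mull A B u v : quad A (B *m u) v = quad (B^T *m A) u v.
Proof. by rewrite /quad trmx_mul !mulmxA. Qed.

Lemma quad1 v : quad 1%:M v v = \sum_(i < p) v i 0 ^+ 2.
Proof.
rewrite /quad mulmx1 mxE; apply: eq_bigr => i _.
by rewrite mxE expr2.
Qed.

Lemma quad1_ge0 v : 0 <= quad 1%:M v v.
Proof. by rewrite quad1; apply: sumr_ge0 => i _; apply: sqr_ge0. Qed.

Lemma quad1_eq0 v : quad 1%:M v v = 0 -> v = 0.
Proof.
rewrite quad1 => /eqP; rewrite psumr_eq0 => [/allP v0|i _]; last exact: sqr_ge0.
apply/matrixP => i j; rewrite ord1 mxE; apply/eqP.
by have := v0 i (mem_index_enum i); rewrite sqrf_eq0.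
Qed.

Lemma quad1_gt0 v : v != 0 -> 0 < quad 1%:M v v.
Proof.
move=> v0; rewrite lt_neqAle quad1_ge0 andbT eq_sym.
by apply: contraNN v0 => /eqP/quad1_eq0 ->.
Qed.

Lemma quad_delta A i j : quad A (delta_mx i 0) (delta_mx j 0) = A i j.
Proof. by rewrite /quad trmx_delta -rowE -colE !mxE. Qed.

Lemma psd1 : psd (1%:M : 'M[R]_p).
Proof. by split; [rewrite trmx1 | exact: quad1_ge0]. Qed.

Lemma psd0 : psd (0 : 'M[R]_p).
Proof. by split=> [|v]; rewrite ?trmx0 // /quad mulmx0 mul0mx mxE. Qed.

Lemma psdD A B : psd A -> psd B -> psd (A + B).
Proof.
move=> [sA pA] [sB pB]; split=> [|v]; first by rewrite linearD /= sA sB.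
by rewrite quadDm addr_ge0.
Qed.

Lemma psdZ c A : 0 <= c -> psd A -> psd (c *: A).
Proof.
move=> c0 [sA pA]; split=> [|v]; first by rewrite linearZ /= sA.
by rewrite quadZm mulr_ge0.
Qed.

Lemma psd_scalar c : 0 <= c -> psd (c%:M : 'M[R]_p).
Proof. by move=> c0; rewrite -scalemx1; apply: psdZ => //; apply: psd1. Qed.

Lemma psd_sum (I : finType) (A : I -> 'M[R]_p) :
  (forall i, psd (A i)) -> psd (\sum_i A i).
Proof. by move=> pA; elim/big_ind: _ => //; [exact: psd0 | exact: psdD]. Qed.

Lemma psd_conj A B : psd A -> psd (B^T *m A *m B).
Proof.
move=> [sA pA]; split=> [|v]; first by rewrite !trmx_mul trmxK sA mulmxA.
by rewrite -quad_mulr -quad_mull.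
Qed.

Lemma psd_cauchy_schwarz A u v : psd A ->
  quad A u v ^+ 2 <= quad A u u * quad A v v.
Proof.
move=> [sA pA]; set a := quad A u u; set b := quad A u v; set c := quad A v v.
have disc s t : 0 <= s ^+ 2 * a + 2 * (s * t * b) + t ^+ 2 * c.
  have := pA (s *: u + t *: v).
  rewrite !(quadDl, quadDr, quadZl, quadZr) (quadC v u sA) -/a -/b -/c.
  by congr (_ <= _); ring.
have [c0|c0] := ltrP 0 c.
  rewrite -subr_ge0 -(pmulr_rge0 _ c0).
  (* This choice of coefficients gives [c * (a * c - b ^+ 2)]. *)
  by have := disc c (- b); congr (_ <= _); ring.
have c_eq0 : c = 0 by apply/eqP; rewrite eq_le c0 pA.
have [->|b0] := eqVneq b 0; first by rewrite expr0n c_eq0 mulr0.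
(* With [c = 0] the form is affine in the second coefficient, chosen here so that the value is
   [- a - 2 < 0]. *)
have := disc 1 (- (a + 1) / b); rewrite c_eq0.
have -> : 1 ^+ 2 * a + 2 * (1 * (- (a + 1) / b) * b) +
  (- (a + 1) / b) ^+ 2 * 0 = - a - 2 by field.
by have := pA u; rewrite -/a; lra.
Qed.

(** Cauchy-Schwarz against each basis vector kills each coordinate of [A *m v]. *)
Lemma psd_quad_eq0 A v : psd A -> quad A v v = 0 -> A *m v = 0.
Proof.
move=> pA v0; apply/colP => i; rewrite [RHS]mxE.
have := psd_cauchy_schwarz (delta_mx i 0) v pA; rewrite v0 mulr0 => le0.
have /eqP : quad A (delta_mx i 0) v == 0.
  by rewrite -sqrf_eq0 eq_le le0 sqr_ge0.
by rewrite /quad trmx_delta -rowE -row_mul mxE.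
Qed.

Lemma psd_mxtrace_ge0 A : psd A -> 0 <= \tr A.
Proof.
by move=> [_ pA]; apply: sumr_ge0 => i _; rewrite -quad_delta pA.
Qed.

Lemma psd_mxtrace_eq0 A : psd A -> \tr A = 0 -> A = 0.
Proof.
move=> psdA /eqP; rewrite psumr_eq0 => [/allP tr0|i _]; last first.
  by rewrite -quad_delta; apply: psdA.2.
apply/matrixP => i j; rewrite [RHS]mxE.
have /implyP/(_ isT)/eqP := tr0 j (mem_index_enum j).
rewrite -[A j j]quad_delta => /(psd_quad_eq0 psdA)/colP/(_ i).
by rewrite -colE mxE => ->; rewrite mxE.
Qed.

Lemma pd_quad_gt0 A v : pd A -> v != 0 -> 0 < quad A v v.
Proof.
move=> [psdA uA] v0; rewrite lt_neqAle psdA.2 andbT eq_sym.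
apply: contraNN v0 => /eqP /(psd_quad_eq0 psdA) Av0.
by rewrite -(mulKmx uA v) Av0 mulmx0.
Qed.

Lemma pdDl A B : pd A -> psd B -> pd (A + B).
Proof.
move=> pdA psdB; split; first by apply: psdD => //; exact: pdA.1.
apply: unitmx_ker => v /(congr1 (fun w => (v^T *m w) 0 0)).
rewrite mulmxA mulmx0 [RHS]mxE => Q0; apply/eqP; apply: contraT => v0.
have := pd_quad_gt0 pdA v0; have := psdB.2 v.
move: Q0; rewrite -[LHS]/(quad (A + B) v v) quadDm; lra.
Qed.

Lemma pdZ c A : 0 < c -> pd A -> pd (c *: A).
Proof.
move=> c0 [psdA uA]; split; first by apply: psdZ => //; apply: ltW.
by rewrite unitmxZ // unitfE gt_eqF.
Qed.

Lemma pd_sum (I : finType) (A : I -> 'M[R]_p) j :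
  (forall i, psd (A i)) -> pd (A j) -> pd (\sum_i A i).
Proof.
move=> pA pj; rewrite (bigD1 j) //=; apply: pdDl => //.
by elim/big_ind: _ => //; [exact: psd0 | exact: psdD].
Qed.

(** The inverse is the congruence of [A] by its own inverse. *)
Lemma psd_inv A : psd A -> A \in unitmx -> psd (invmx A).
Proof.
move=> pA uA; have -> : invmx A = (invmx A)^T *m A *m invmx A.
  by rewrite trmx_inv pA.1 mulVmx // mul1mx.
exact: psd_conj.
Qed.

Lemma pd_inv A : pd A -> pd (invmx A).
Proof. by move=> [pA uA]; split; [apply: psd_inv | rewrite unitmx_inv]. Qed.

Lemma pd_conj_eq0 A B : pd A -> B^T *m A *m B = 0 -> B = 0.
Proof.
move=> pdA BAB0; apply/matrixP => i j; rewrite [RHS]mxE.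
have Bj0 : B *m (delta_mx j 0 : 'cV_p) = 0.
  apply/eqP; apply: contraT => Bj0.
  have := pd_quad_gt0 pdA Bj0.
  by rewrite quad_mulr quad_mull mulmxA BAB0 /quad mulmx0 mul0mx mxE ltxx.
by move: Bj0 => /colP/(_ i); rewrite -colE mxE => ->; rewrite mxE.
Qed.

(** Cauchy-Schwarz against the i-th basis vector bounds the squared i-th coordinate of [A *m v] by
    [A i i * quad A v v]; the sum over i produces the trace. *)
Lemma psd_norm_le A v : psd A ->
  quad 1%:M (A *m v) (A *m v) <= \tr A * quad A v v.
Proof.
move=> psdA; rewrite quad1 /mxtrace mulr_suml; apply: ler_sum => i _.
have := psd_cauchy_schwarz (delta_mx i 0) v psdA.
by rewrite quad_delta /quad trmx_delta -rowE -row_mul mxE.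
Qed.

Lemma psd_quad_le_mxtrace A v : psd A ->
  quad A v v <= \tr A * quad 1%:M v v.
Proof.
move=> psdA; have [->|q0] := eqVneq (quad A v v) 0.
  by rewrite mulr_ge0 ?quad1_ge0 ?psd_mxtrace_ge0.
have qpos : 0 < quad A v v by rewrite lt_neqAle eq_sym q0; apply: psdA.2.
rewrite -(ler_pM2r qpos) -expr2.
have := psd_cauchy_schwarz v (A *m v) psd1.
rewrite quad_mulr mul1mx => /le_trans; apply.
rewrite mulrAC mulrC ler_wpM2r ?quad1_ge0 //; exact: psd_norm_le.
Qed.

(** This is [psd_norm_le] for the inverse of [A], at the vector [A *m v]. It keeps the form of [A]
    away from zero without any spectral decomposition. *)
Lemma pd_lower_bound A v : pd A ->
  quad 1%:M v v <= \tr (invmx A) * quad A v v.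
Proof.
move=> [psdA uA]; have := psd_norm_le (A *m v) (psd_inv psdA uA).
by rewrite mulKmx // quad_mulr mulVmx // quad_mull mulmx1 psdA.1.
Qed.

End Quad.

(** * The greatest eigenvalue *)

Lemma eigenvalue_notin_unitmx (F : fieldType) (p : nat) (A : 'M[F]_p) a :
  eigenvalue A a = (a%:M - A \notin unitmx).
Proof.
rewrite /eigenvalue /eigenspace kermx_eq0 row_free_unit -(opprB a%:M A).
by rewrite -scaleN1r unitmxZ ?unitrN1.
Qed.

Section LambdaMax.
Variables (R : realType) (p : nat).
Hypothesis p_gt0 : (0 < p)%N.
Implicit Types (M : 'M[R]_p) (v : 'cV[R]_p).

Lemma quad_scalar_sub c M v :
  quad (c%:M - M) v v = c * quad 1%:M v v - quad M v v.
Proof. by rewrite quadDm quadNm -[c%:M]scalemx1 quadZm. Qed.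

Lemma psd_scalar_sub c M : psd M ->
  psd (c%:M - M) <-> forall v, quad M v v <= c * quad 1%:M v v.
Proof.
move=> [sM _]; split=> [[_ h] v|h].
  by rewrite -subr_ge0 -quad_scalar_sub.
split=> [|v]; first by rewrite linearB /= tr_scalar_mx sM.
by rewrite quad_scalar_sub subr_ge0.
Qed.

Lemma eigenvalue_le c M a : M^T = M -> psd (c%:M - M) -> eigenvalue M a ->
  a <= c.
Proof.
move=> sM [_ cM] /eigenvalueP [u uM u0].
have v0 : u^T != 0 by rewrite -trmx0 (inj_eq trmx_inj).
rewrite -(ler_pM2r (quad1_gt0 v0)); have := cM u^T.
rewrite quad_scalar_sub subr_ge0 => le_c; apply: le_trans le_c.
by rewrite {2}/quad trmxK uM -scalemxAl mxE /quad mulmx1 trmxK.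
Qed.

(* The greatest eigenvalue is the infimum of the [c] with [M <= c I]: at the
   infimum [c I - M] is singular, since otherwise it would be bounded below by
   a positive multiple of the identity. *)
Lemma lambda_max_psd M : psd M ->
  eigenvalue M (lambda_max M) /\ psd ((lambda_max M)%:M - M).
Proof.
move=> psdM; pose S := [set c : R | psd (c%:M - M)].
have Str : S (\tr M).
  by apply/psd_scalar_sub => // v; apply: psd_quad_le_mxtrace.
have S0 : lbound S 0.
  move=> c /(psd_scalar_sub c psdM) /(_ (delta_mx (Ordinal p_gt0) 0)).
  rewrite quad_delta [quad 1%:M _ _]quad_delta mxE eqxx mulr1; apply: le_trans.
  by rewrite -quad_delta; apply: psdM.2.
have infS : has_inf S by split; [exists (\tr M) | exists 0].
pose mu := inf S.
have Smu : S mu.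
  apply/psd_scalar_sub => // v; have [->|v0] := eqVneq v 0.
    by rewrite -(scale0r (0 : 'cV[R]_p)) !quadZl !mul0r mulr0.
  rewrite -ler_pdivrMr ?quad1_gt0 //; apply: lb_le_inf; first exact: infS.1.
  move=> c /(psd_scalar_sub c psdM) /(_ v).
  by rewrite ler_pdivrMr ?quad1_gt0.
have mu_eig : eigenvalue M mu.
  rewrite eigenvalue_notin_unitmx; apply/negP => mu_unit.
  have pdN : pd (mu%:M - M) by split.
  have tr_gt0 : 0 < \tr (invmx (mu%:M - M)).
    have pdI := pd_inv pdN.
    rewrite lt_neqAle psd_mxtrace_ge0 ?andbT; last exact: pdI.1.
    apply/eqP => /esym /(psd_mxtrace_eq0 pdI.1) I0.
    have := mulVmx mu_unit; rewrite I0 mul0mx => /matrixP.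
    move/(_ (Ordinal p_gt0) (Ordinal p_gt0)); rewrite !mxE eqxx => /eqP.
    by rewrite eq_sym oner_eq0.
  (* By [pd_lower_bound], [mu] can be lowered by the inverse of this trace while staying in [S],
     against its minimality. *)
  have : S (mu - (\tr (invmx (mu%:M - M)))^-1).
    apply/psd_scalar_sub => // v; have := pd_lower_bound v pdN.
    rewrite -ler_pdivrMl // quad_scalar_sub mulrBl; lra.
  move=> /(ge_inf infS.2); rewrite -/mu.
  have : 0 < (\tr (invmx (mu%:M - M)))^-1 by rewrite invr_gt0.
  lra.
suff -> : lambda_max M = mu by [].
apply/eqP; rewrite eq_le; apply/andP; split.
  apply: ge_sup; first by exists mu.
  by move=> a /(eigenvalue_le psdM.1 Smu).
apply: ub_le_sup => //; exists mu.
by move=> a /(eigenvalue_le psdM.1 Smu).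
Qed.

Lemma lambda_max_ge0 M : psd M -> 0 <= lambda_max M.
Proof.
move=> psdM; have [_ pM] := lambda_max_psd psdM.
have := (psd_scalar_sub _ psdM).1 pM (delta_mx (Ordinal p_gt0) 0).
rewrite quad_delta [quad 1%:M _ _]quad_delta mxE eqxx mulr1; apply: le_trans.
by rewrite -quad_delta; apply: psdM.2.
Qed.

(** The greatest eigenvalue is attained at some nonzero u, and the form of [1%:M - M] at u is
    [1 - lambda_max M] times the squared norm of u. *)
Lemma lambda_max_lt1 M : psd M -> pd (1%:M - M) -> lambda_max M < 1.
Proof.
move=> psdM pdM; have [+ _] := lambda_max_psd psdM.
move=> /eigenvalueP [u uM u0].
have v0 : u^T != 0 by rewrite -trmx0 (inj_eq trmx_inj).
rewrite -(ltr_pM2r (quad1_gt0 v0)) mul1r -subr_gt0.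
have := pd_quad_gt0 pdM v0; rewrite quad_scalar_sub mul1r; congr (_ < _ - _).
by rewrite {1}/quad trmxK uM -scalemxAl mxE /quad mulmx1 trmxK.
Qed.

Lemma norm2E v : norm2 v = Num.sqrt (quad 1%:M v v).
Proof. by rewrite /norm2 quad1. Qed.

(** With w = M v, the squared norm of w is the form of M at (w, v). Cauchy-Schwarz for M and the
    bound of M by mu I give |w|^4 <= mu^2 |w|^2 |v|^2, and |w|^2 cancels. *)
Lemma norm2_mulmx_le M v : psd M ->
  norm2 (M *m v) <= lambda_max M * norm2 v.
Proof.
move=> psdM; have mu0 := lambda_max_ge0 psdM.
have [_ /(psd_scalar_sub _ psdM) muM] := lambda_max_psd psdM.
set mu := lambda_max M in mu0 muM *.
rewrite !norm2E -(ger0_norm mu0) -sqrtr_sqr -sqrtrM ?sqr_ge0 //.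
apply: ler_wsqrtr; set w := M *m v.
have [->|w0] := eqVneq (quad 1%:M w w) 0.
  by rewrite mulr_ge0 ?sqr_ge0 ?quad1_ge0.
have wpos : 0 < quad 1%:M w w by rewrite lt_neqAle eq_sym w0 quad1_ge0.
rewrite -(ler_pM2r wpos) -[X in X <= _]expr2.
have -> : quad 1%:M w w = quad M w v by rewrite {2}/w quad_mulr mul1mx.
apply: le_trans (psd_cauchy_schwarz _ _ psdM) _.
have -> : mu ^+ 2 * quad 1%:M v v * quad M w v =
  (mu * quad 1%:M w w) * (mu * quad 1%:M v v).
  have -> : quad 1%:M w w = quad M w v by rewrite {2}/w quad_mulr mul1mx.
  by ring.
by apply: ler_pM; rewrite ?muM ?psdM.2.
Qed.

End LambdaMax.

(** * Limits and derivatives of matrix-valued functions *)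

Section MatrixLimits.
Context {T : Type} (F : set_system T) {FF : Filter F} {R : realType}.

Lemma cvg_mxP m n (f : T -> 'M[R]_(m, n)) (A : 'M[R]_(m, n)) :
  f @ F --> A <-> forall i j, f x i j @[x --> F] --> A i j.
Proof.
split=> [fA i j|fA].
  apply: (@cvg_comp _ _ _ f (fun M : 'M[R]_(m, n) => M i j) F (nbhs A)) => //.
  exact: coord_continuous.
apply/cvgrPdist_lt => e e0.
have : \forall x \near F, forall i j, `|A i j - f x i j| < e.
  apply: filter_forall => i; apply: filter_forall => j.
  by move: e e0; apply/cvgrPdist_lt; apply: fA.
apply: filterS => x fx; rewrite [X in X < _]mx_normrE.
apply: bigmax_lt => // -[i j] _ /=; by rewrite !mxE.
Qed.

Lemma cvg_mulmx m n p (f : T -> 'M[R]_(m, n)) (g : T -> 'M[R]_(n, p))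
    (A : 'M[R]_(m, n)) (B : 'M[R]_(n, p)) :
  f @ F --> A -> g @ F --> B -> f x *m g x @[x --> F] --> A *m B.
Proof.
move=> /cvg_mxP fA /cvg_mxP gB; apply/cvg_mxP => i j.
under eq_cvg do rewrite mxE.
rewrite mxE; apply: cvg_big => [|l _]; first exact: add_continuous.
by apply: cvgM.
Qed.

Lemma cvg_mxtrace n (f : T -> 'M[R]_n) (A : 'M[R]_n) :
  f @ F --> A -> \tr (f x) @[x --> F] --> \tr A.
Proof.
move=> /cvg_mxP fA; apply: cvg_big => [|l _]; first exact: add_continuous.
exact: fA.
Qed.

Lemma cvg_det n (f : T -> 'M[R]_n) (A : 'M[R]_n) :
  f @ F --> A -> \det (f x) @[x --> F] --> \det A.
Proof.
move=> /cvg_mxP fA; apply: cvg_big => [|s _]; first exact: add_continuous.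
apply: cvgM; first exact: cvg_cst.
by apply: cvg_big => [|i _]; [exact: mul_continuous | exact: fA].
Qed.

Lemma cvg_adjugate n (f : T -> 'M[R]_n) (A : 'M[R]_n) :
  f @ F --> A -> \adj (f x) @[x --> F] --> \adj A.
Proof.
move=> /cvg_mxP fA; apply/cvg_mxP => i j.
under eq_cvg do rewrite mxE /cofactor.
rewrite mxE /cofactor; apply: cvgM; first exact: cvg_cst.
apply: cvg_det; apply/cvg_mxP => a b.
under eq_cvg do rewrite !mxE.
by rewrite !mxE; apply: fA.
Qed.

Lemma near_unitmx n (f : T -> 'M[R]_n) (A : 'M[R]_n) : A \in unitmx ->
  f @ F --> A -> \forall x \near F, f x \in unitmx.
Proof.
rewrite unitmxE unitfE => uA /cvg_det fA.
near=> x; rewrite unitmxE unitfE; near: x.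
exact: (cvgr_neq0 (\det A) fA uA).
Unshelve. all: by end_near. Qed.

(** By Cramer's formula the inverse is the adjugate over the determinant, both polynomial in the
    entries. As [invmx] is the identity on singular matrices, the formula is used only where [f x]
    is invertible. *)
Lemma cvg_invmx n (f : T -> 'M[R]_n) (A : 'M[R]_n) : A \in unitmx ->
  f @ F --> A -> invmx (f x) @[x --> F] --> invmx A.
Proof.
move=> uA fA; rewrite [X in _ --> X]/invmx uA.
apply: cvg_trans (cvgZ (cvgV _ (cvg_det fA)) (cvg_adjugate fA)); last first.
  by rewrite -unitfE -unitmxE.
apply: near_eq_cvg; have := near_unitmx uA fA; apply: filterS => x ux.
by rewrite /invmx ux.
Qed.

Lemma cvg_mxsum m n (I : finType) (f : I -> T -> 'M[R]_(m, n))
    (A : I -> 'M[R]_(m, n)) :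
  (forall i, f i @ F --> A i) -> \sum_i f i x @[x --> F] --> \sum_i A i.
Proof.
move=> fA; apply: cvg_big => [|i _]; first exact: add_continuous.
exact: fA.
Qed.

End MatrixLimits.

Section MatrixDerivative.
Variables (R : realType) (p : nat).
Implicit Types (f g : R -> 'M[R]_p) (x y : R) (A B : 'M[R]_p).

(** The quotient has the shape of [diff_quot], so that taking traces leads directly to real
    difference quotients. *)
Definition mx_derive_at f x A :=
  (y - x)^-1 *: (f y - f x) @[y --> x^'] --> A.

Lemma mx_derive_at_cvg f x A : mx_derive_at f x A -> f y @[y --> x^'] --> f x.
Proof.
move=> fA.
have idx : y @[y --> x^'] --> x by exact: nbhs_dnbhs.
have y0 : y - x @[y --> x^'] --> 0.
  by rewrite -(subrr x); apply: cvgB idx _; exact: cvg_cst.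
have : (y - x) *: ((y - x)^-1 *: (f y - f x)) + f x @[y --> x^'] -->
  0 *: A + f x by apply: cvgD (cvgZ y0 fA) _; exact: cvg_cst.
rewrite scale0r add0r; apply: cvg_trans; apply: near_eq_cvg.
have := nbhs_dnbhs_neq x; apply: filterS => y yx /=.
by rewrite scalerA divff ?subr_eq0 // scale1r subrK.
Qed.

Lemma mx_derive_at_eq f x A B :
  mx_derive_at f x A -> A = B -> mx_derive_at f x B.
Proof. by move=> fA <-. Qed.

Lemma mx_derive_at_cst C x : mx_derive_at (fun=> C) x 0.
Proof.
rewrite /mx_derive_at; under eq_cvg do rewrite subrr scaler0.
exact: cvg_cst.
Qed.

Lemma mx_derive_at_scalar x : mx_derive_at (fun y => y%:M) x 1%:M.
Proof.
apply: cvg_near_cst; have := nbhs_dnbhs_neq x; apply: filterS => y yx /=.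
by rewrite -raddfB /= scale_scalar_mx mulVf // subr_eq0.
Qed.

Lemma mx_derive_atD f g x A B : mx_derive_at f x A -> mx_derive_at g x B ->
  mx_derive_at (fun y => f y + g y) x (A + B).
Proof.
move=> fA gB; apply: cvg_trans (cvgD fA gB); apply: near_eq_cvg.
by near=> y; rewrite ?fctE -scalerDr opprD addrACA.
Unshelve. all: by end_near. Qed.

Lemma mx_derive_at_sum (I : finType) (f : I -> R -> 'M[R]_p) x
    (A : I -> 'M[R]_p) :
  (forall i, mx_derive_at (f i) x (A i)) ->
  mx_derive_at (fun y => \sum_i f i y) x (\sum_i A i).
Proof.
move=> fA; apply: cvg_trans (cvg_mxsum fA); apply: near_eq_cvg.
by near=> y; rewrite /= -scaler_sumr sumrB.
Unshelve. all: by end_near. Qed.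

Lemma mx_derive_atZ c f x A : mx_derive_at f x A ->
  mx_derive_at (fun y => c *: f y) x (c *: A).
Proof.
move=> fA; apply: cvg_trans (cvgZ (cvg_cst c) fA); apply: near_eq_cvg.
by near=> y; rewrite -scalerBr !scalerA mulrC.
Unshelve. all: by end_near. Qed.

Lemma mx_derive_atM f g x A B : mx_derive_at f x A -> mx_derive_at g x B ->
  mx_derive_at (fun y => f y *m g y) x (A *m g x + f x *m B).
Proof.
move=> fA gB.
apply: cvg_trans (cvgD (cvg_mulmx fA (mx_derive_at_cvg gB))
  (cvg_mulmx (cvg_cst (f x)) gB)); apply: near_eq_cvg; near=> y => /=.
rewrite ?fctE -scalemxAl -scalemxAr -scalerDr; congr (_ *: _).
by rewrite mulmxBl mulmxBr addrA subrK.
Unshelve. all: by end_near. Qed.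

(** The difference of the inverses at y and x is f(y)^-1 (f(x) - f(y)) f(x)^-1, and f(y)^-1 tends to
    f(x)^-1. *)
Lemma mx_derive_atV f x A : f x \in unitmx -> mx_derive_at f x A ->
  mx_derive_at (fun y => invmx (f y)) x
    (- (invmx (f x) *m A *m invmx (f x))).
Proof.
move=> ux fA; have fx := mx_derive_at_cvg fA.
apply: cvg_trans (cvgN (cvg_mulmx (cvg_mulmx (cvg_invmx ux fx) fA)
  (cvg_cst (invmx (f x))))); apply: near_eq_cvg.
near=> y; have uy : f y \in unitmx by near: y; apply: near_unitmx ux fx.
rewrite /= ?fctE -scalemxAr -scalemxAl -scalerN; congr (_ *: _).
rewrite mulmxBr mulmxBl mulVmx // mul1mx -mulmxA mulmxV // mulmx1.
by rewrite opprB.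
Unshelve. all: by end_near. Qed.

Lemma diff_quot_mxtrace f x A : mx_derive_at f x A ->
  diff_quot (fun y => \tr (f y)) x @ x^' --> \tr A.
Proof.
move=> fA; apply: cvg_trans (cvg_mxtrace fA); apply: near_eq_cvg.
by near=> y; rewrite mxtraceZ raddfB mulrC.
Unshelve. all: by end_near. Qed.

(** The change of variable y = t + x passes to [is_derive], on which the monotonicity criteria
    rely. *)
Lemma is_derive_diff_quot (h : R -> R) x a :
  diff_quot h x @ x^' --> a -> is_derive x 1 h a.
Proof.
move=> ha; suff : t^-1 *: (h (t *: 1 + x) - h x) @[t --> 0^'] --> a.
  by move=> c; apply: DeriveDef; [apply/cvg_ex; exists a | exact: cvg_lim].
have sh : t + x @[t --> (0 : R)^'] --> x^'.
  move=> V [e e0 Ve]; exists e => // t /= he t0; apply: Ve.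
    by move: he; rewrite /ball /= sub0r normrN opprD addrC subrK normrN.
  by rewrite -subr_eq0 addrK.
apply: cvg_trans (cvg_comp _ _ sh ha); apply: near_eq_cvg.
by near=> t; rewrite /= /diff_quot addrK scaler1 mulrC.
Unshelve. all: by end_near. Qed.

End MatrixDerivative.

(** * Mean squared error of linear estimators *)

Section LinearEstimator.
Context (d : measure_display) (T : measurableType d) (R : realType).
Context (P : probability T R).

Lemma expectation_bigsum (I : finType) (f : I -> T -> R) :
  (forall i, f i \in Lfun P 1) ->
  ('E_P[fun w => (\sum_i f i w)%R] = \sum_i 'E_P[f i])%E.
Proof.
move=> f1; have -> : (fun w => \sum_i f i w) = \sum_i f i.
  by apply/funext => w; rewrite fct_sumE.
rewrite -[in LHS](big_map f predT id) expectation_sum; last first.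
  by move=> _ /mapP [i _ ->]; apply: f1.
by rewrite big_map.
Qed.

Variables (n : nat) (eps : 'I_n -> {RV P >-> R}) (sigma : R).
Hypothesis noise : white_noise eps sigma.

Lemma noise_Lfun1 j : (eps j : T -> R) \in Lfun P 1.
Proof.
have [eps2 _ _ _] := noise; apply: Lfun_subset12 (eps2 j).
exact: fin_num_measure.
Qed.

Lemma expectation_noiseM j l :
  ('E_P[fun w => (eps j w * eps l w)%R] = (sigma ^+ 2 *+ (j == l))%:E)%E.
Proof.
have [eps2 mean0 var cov0] := noise.
have l1M : ((eps j : T -> R) * (eps l : T -> R)) \in Lfun P 1.
  exact: Lfun2_mul_Lfun1.
have covE := covarianceE (noise_Lfun1 j) (noise_Lfun1 l) l1M.
rewrite !mean0 mule0 sube0 in covE.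
transitivity (covariance P (eps j) (eps l)); first by rewrite covE.
by have [<-|jl] := eqVneq j l; [exact: var | exact: cov0].
Qed.

Lemma expectation_affine (c : R) (a : 'I_n -> R) :
  ('E_P[fun w => (c + \sum_j a j * eps j w)%R] = c%:E)%E.
Proof.
have [_ mean0 _ _] := noise.
have a1 j : (a j \o* eps j : T -> R) \in Lfun P 1.
  by apply: Lfun_scale => //; exact: noise_Lfun1.
have -> : (fun w => c + \sum_j a j * eps j w) =
  (cst c) \+ (fun w => \sum_j (a j \o* eps j) w).
  by apply/funext => w /=; congr (_ + _); apply: eq_bigr => j _; rewrite mulrC.
rewrite expectationD ?Lfun_cst //; last first.
  rewrite (_ : (fun _ => _) = \sum_j (a j \o* eps j)) ?rpred_sum //.
  by apply/funext => w; rewrite fct_sumE.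
rewrite expectation_cst expectation_bigsum // big1 ?adde0 // => j _.
by rewrite expectationZl ?mean0 ?mule0 // noise_Lfun1.
Qed.

(** The squared norm of A eps expands into products of two noise coordinates. Uncorrelatedness
    leaves the diagonal terms, whose coefficients sum to the squared Frobenius norm of A. *)
Lemma mse_linear p (A : 'M[R]_(p, n)) (est : T -> 'cV[R]_p) beta :
  (forall w, est w - beta = A *m \col_j eps j w) ->
  mse P est beta = (sigma ^+ 2 * \tr (A *m A^T))%:E.
Proof.
move=> estE; have [eps2 _ _ _] := noise.
(* An index [(i, (j, l))] names one term of the expanded square of the i-th coordinate. *)
pose f (q : 'I_p * ('I_n * 'I_n)) : T -> R :=
  (A q.1 q.2.1 * A q.1 q.2.2) \o* (eps q.2.1 \* eps q.2.2).
have f1 q : f q \in Lfun P 1.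
  by apply: Lfun_scale => //; exact: Lfun2_mul_Lfun1.
have normE w : norm2 (est w - beta) ^+ 2 = \sum_q f q w.
  rewrite norm2E sqr_sqrtr ?quad1_ge0 // quad1 estE.
  rewrite -(pair_bigA _ (fun i jl => f (i, jl) w)) /=; apply: eq_bigr => i _.
  rewrite -(pair_bigA _ (fun j l => f (i, (j, l)) w)) /= expr2 mxE.
  rewrite mulr_suml; apply: eq_bigr => j _; rewrite mulr_sumr.
  by apply: eq_bigr => l _; rewrite /f /= !mxE; ring.
rewrite /mse; under eq_fun do rewrite normE.
rewrite expectation_bigsum //.
under eq_bigr => q _.
  rewrite expectationZl ?expectation_noiseM; last exact: Lfun2_mul_Lfun1.
  rewrite -EFinM; over.
rewrite sumEFin; congr EFin.
rewrite -(pair_bigA _ (fun i jl => A i jl.1 * A i jl.2 *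
  (sigma ^+ 2 *+ (jl.1 == jl.2)))) /= mulr_sumr; apply: eq_bigr => i _.
rewrite -(pair_bigA _ (fun j l => A i j * A i l * (sigma ^+ 2 *+ (j == l)))) /=.
rewrite mxE mulr_sumr; apply: eq_bigr => j _.
rewrite (bigD1 j) //= big1 => [|l lj]; last first.
  by rewrite eq_sym (negbTE lj) mulr0.
by rewrite eqxx !mxE addr0 mulr1n mulrC.
Qed.

End LinearEstimator.

(** * Sums of resolvents *)

Lemma psd_trmx_mul (R : realFieldType) (m p : nat) (B : 'M[R]_(m, p)) :
  psd (B^T *m B).
Proof.
split=> [|v]; first by rewrite trmx_mul trmxK.
have -> : quad (B^T *m B) v v = quad 1%:M (B *m v) (B *m v).
  by rewrite /quad mulmx1 trmx_mul !mulmxA.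
exact: quad1_ge0.
Qed.

Section Resolvent.
Variables (R : realFieldType) (p : nat).
Implicit Types (S : 'M[R]_p) (c : R).

Lemma resolvent_comm S c : S + c%:M \in unitmx ->
  invmx (S + c%:M) *m S = S *m invmx (S + c%:M).
Proof.
set G := S + c%:M => uG.
have GS : G *m S = S *m G by rewrite mulmxDl mulmxDr scalar_mxC.
by rewrite -[in LHS](mulmxK uG S) -GS -!mulmxA mulKmx.
Qed.

(** With G = S + c I, the product G^-1 S equals G^-1 (S^2 + c S) G^-1, a congruence of a positive
    semidefinite matrix. *)
Lemma psd_resolvent_mul S c : psd S -> 0 <= c -> S + c%:M \in unitmx ->
  psd (invmx (S + c%:M) *m S).
Proof.
move=> pS c0 uG.
have pG : psd (S + c%:M) by apply: psdD => //; apply: psd_scalar.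
have symG : (invmx (S + c%:M))^T = invmx (S + c%:M) by rewrite trmx_inv pG.1.
have -> : invmx (S + c%:M) *m S =
    (invmx (S + c%:M))^T *m (S^T *m 1%:M *m S + c *: S) *m invmx (S + c%:M).
  rewrite symG mulmx1 pS.1 -mul_mx_scalar -mulmxDr.
  by rewrite -!mulmxA mulmxV // mulmx1.
apply: psd_conj; apply: psdD; last exact: psdZ.
by apply: psd_conj; exact: psd1.
Qed.

Lemma pd_resolvent_mul S c : pd S -> 0 <= c -> pd (invmx (S + c%:M) *m S).
Proof.
move=> pS c0; have uG := (pdDl pS (psd_scalar p c0)).2.
split; first exact: psd_resolvent_mul pS.1 c0 uG.
by rewrite unitmx_mul unitmx_inv uG pS.2.
Qed.

End Resolvent.

(** * Derivative and sign for the trace of Delta^-2 B *)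

Section ResolventSum.
Variables (R : realType) (k p : nat) (S : 'I_k -> 'M[R]_p).
Hypothesis k_gt0 : (0 < k)%N.
Hypothesis pdS : forall i, pd (S i).
Implicit Types (x y : R) (m : nat) (i j : 'I_k).

Let Res y i : 'M[R]_p := invmx (S i + y%:M).
Let rs y m : 'M[R]_p := \sum_(i < k) Res y i ^+ m *m S i.
Let Delta y := rs y 1.

Let unit_shift x i : 0 <= x -> S i + x%:M \in unitmx.
Proof. by move=> x0; exact: (pdDl (pdS i) (psd_scalar p x0)).2. Qed.

Let ResC x i : 0 <= x -> Res x i *m S i = S i *m Res x i.
Proof. by move=> x0; apply: resolvent_comm; exact: unit_shift. Qed.

Let Res_sym x i : (Res x i)^T = Res x i.
Proof. by rewrite trmx_inv linearD /= (pdS i).1.1 tr_scalar_mx. Qed.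

Let pd_ResS x i : 0 <= x -> pd (Res x i *m S i).
Proof. exact: pd_resolvent_mul. Qed.

Lemma pd_resolvent_sum1 x : 0 <= x -> pd (Delta x).
Proof.
move=> x0; apply: (pd_sum (j := Ordinal k_gt0)) => [i|]; rewrite expr1.
  exact: (pd_ResS i x0).1.
exact: pd_ResS.
Qed.

Let derive_Res x i : 0 <= x ->
  mx_derive_at (fun y => Res y i) x (- (Res x i *m Res x i)).
Proof.
move=> x0; have dS := mx_derive_atD (@mx_derive_at_cst R p (S i) x)
  (@mx_derive_at_scalar R p x).
apply: mx_derive_at_eq (mx_derive_atV (unit_shift i x0) dS) _.
by rewrite add0r mulmx1.
Qed.

Let derive_rs1 x : 0 <= x -> mx_derive_at (rs^~ 1%N) x (- rs x 2).
Proof.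
move=> x0; have -> : rs^~ 1%N = fun y => \sum_i Res y i *m S i.
  by apply/funext => y; apply: eq_bigr => i _; rewrite expr1.
apply: mx_derive_at_eq (mx_derive_at_sum (fun i =>
  mx_derive_atM (@derive_Res x i x0) (@mx_derive_at_cst R p (S i) x))) _.
rewrite /rs -sumrN; apply: eq_bigr => i _.
by rewrite mulmx0 addr0 mulNmx.
Qed.

Let derive_rs2 x : 0 <= x -> mx_derive_at (rs^~ 2%N) x (- (2 *: rs x 3)).
Proof.
move=> x0; have -> : rs^~ 2%N = fun y => \sum_i (Res y i *m Res y i) *m S i.
  by apply/funext => y; apply: eq_bigr => i _; rewrite expr2.
apply: mx_derive_at_eq (mx_derive_at_sum (fun i =>
  mx_derive_atM (mx_derive_atM (@derive_Res x i x0) (@derive_Res x i x0))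
    (@mx_derive_at_cst R p (S i) x))) _.
rewrite /rs scaler_sumr -sumrN; apply: eq_bigr => i _.
rewrite mulmx0 addr0 mulmxN mulNmx -opprD mulNmx scaler_nat mulr2n.
rewrite -mulmxDl; congr (- (_ *m _)).
by rewrite !exprS expr0 mulr1 -!mulmxE !mulmxA.
Qed.

Lemma diff_quot_resolvent_trace c x : 0 <= x ->
  diff_quot (fun y => c * \tr (invmx (Delta y) ^+ 2 *m rs y 2)) x @ x^' -->
  2 * c * \tr (invmx (Delta x) *m rs x 2 *m invmx (Delta x) ^+ 2 *m rs x 2 -
               invmx (Delta x) ^+ 2 *m rs x 3).
Proof.
move=> x0; have uD := (pd_resolvent_sum1 x0).2.
have dV := mx_derive_atV uD (derive_rs1 x0).
have := diff_quot_mxtrace (mx_derive_atZ (c := c)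
  (mx_derive_atM (mx_derive_atM dV dV) (derive_rs2 x0))).
set D := invmx (rs x 1); rewrite -/(Delta x) -/D.
have -> : (fun y => \tr (c *: (invmx (rs y 1) *m invmx (rs y 1) *m rs y 2))) =
  (fun y => c * \tr (invmx (Delta y) ^+ 2 *m rs y 2)).
  by apply/funext => y; rewrite mxtraceZ expr2 mulmxE.
suff -> : \tr (c *: ((- (D *m - rs x 2 *m D) *m D + D *m - (D *m - rs x 2 *m D))
    *m rs x 2 + D *m D *m - (2 *: rs x 3))) =
  2 * c * \tr (D *m rs x 2 *m D ^+ 2 *m rs x 2 - D ^+ 2 *m rs x 3) by [].
(* Each of the two factors D contributes D B D to the product rule. The two resulting terms are
   cyclic rotations of each other, hence the factor 2. *)
rewrite !(mulmxN, mulNmx) !opprK mxtraceZ mulmxDl !mxtraceD raddfN /=.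
rewrite -scalemxAr mxtraceZ expr2 -mulmxE -!mulmxA.
rewrite [\tr (D *m (D *m (rs x 2 *m _)))]mxtrace_mulC -!mulmxA.
rewrite [\tr (D *m (rs x 2 *m (D *m (rs x 2 *m D))))]mxtrace_mulC -!mulmxA.
rewrite [X in _ + X + _]mxtrace_mulC -!mulmxA; ring.
Qed.

(** This is (R_i - Q) D, the right factor of the i-th square. *)
Let K x i := (Res x i - invmx (Delta x) *m rs x 2) *m invmx (Delta x).

(* With [D = Delta^-1], [B = rs 2] and [C = rs 3] this is the Schur complement
   [C - B D B], conjugated by [D], written as a sum of squares. *)
Let schur_sum x : 0 <= x ->
  \tr (invmx (Delta x) *m rs x 2 *m invmx (Delta x) ^+ 2 *m rs x 2 -
       invmx (Delta x) ^+ 2 *m rs x 3) =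
  - \sum_i \tr ((K x i)^T *m (Res x i *m S i) *m K x i).
Proof.
move=> x0; have [[symD _] uD] := pd_resolvent_sum1 x0.
set D := invmx (Delta x); set B := rs x 2.
have symDi : D^T = D by rewrite trmx_inv symD.
have symB : B^T = B.
  rewrite linear_sum /=; apply: eq_bigr => i _.
  rewrite expr2 -mulmxE !trmx_mul Res_sym (pdS i).1.1 mulmxA -ResC //.
  by rewrite -!mulmxA ResC.
have KE i : (K x i)^T *m (Res x i *m S i) *m K x i =
  D *m (Res x i ^+ 3 *m S i - B *m D *m (Res x i ^+ 2 *m S i)
     - Res x i ^+ 2 *m S i *m D *m B
     + B *m D *m (Res x i ^+ 1 *m S i) *m D *m B) *m D.
  rewrite /K -/D -/B trmx_mul linearB /= trmx_mul symDi symB Res_sym.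
  rewrite -!mulmxA; congr (_ *m _); rewrite !mulmxA; congr (_ *m _).
  have SR Z : Z *m S i *m Res x i = Z *m Res x i *m S i.
    by rewrite -!mulmxA ResC.
  rewrite !mulmxBl mulmxBr mulmxBr !mulmxA !SR opprB addrA expr1.
  by rewrite addrAC; congr (_ + _); rewrite addrAC.
under eq_bigr do rewrite KE.
rewrite -raddf_sum /= -mulmx_suml -mulmx_sumr !big_split /= !sumrN.
rewrite -!mulmx_suml -!mulmx_sumr.
rewrite -/(rs x 3) -/(rs x 2) -/B -/(Delta x).
(* The last term sums to B D Delta D B = B D B, which cancels one of the two cross terms. *)
rewrite -[B *m D *m Delta x *m D]mulmxA mulmxV // mulmx1 subrK.
rewrite mulmxBr mulmxBl ![\tr (_ - _)]raddfB /= opprB; congr (_ - _).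
  have -> : D *m B *m D ^+ 2 *m B = (D *m B) *m (D *m D *m B).
    by rewrite expr2 -mulmxE !mulmxA.
  by rewrite mxtrace_mulC [in RHS]mxtrace_mulC !mulmxA.
by rewrite [in RHS]mxtrace_mulC expr2 -mulmxE mulmxA.
Qed.

Lemma resolvent_trace_le0 x : 0 <= x ->
  \tr (invmx (Delta x) *m rs x 2 *m invmx (Delta x) ^+ 2 *m rs x 2 -
       invmx (Delta x) ^+ 2 *m rs x 3) <= 0.
Proof.
move=> x0; rewrite schur_sum // oppr_le0; apply: sumr_ge0 => i _.
by apply: psd_mxtrace_ge0; apply: psd_conj; exact: (pd_ResS i x0).1.
Qed.

Lemma resolvent_trace_lt0 x i j : 0 <= x -> S i <> S j ->
  \tr (invmx (Delta x) *m rs x 2 *m invmx (Delta x) ^+ 2 *m rs x 2 -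
       invmx (Delta x) ^+ 2 *m rs x 3) < 0.
Proof.
move=> x0 Sij; rewrite lt_neqAle resolvent_trace_le0 // andbT.
apply/eqP; rewrite schur_sum // => /eqP; rewrite oppr_eq0 psumr_eq0; last first.
  move=> l _; apply: psd_mxtrace_ge0; apply: psd_conj.
  exact: (pd_ResS l x0).1.
move=> /allP tr0.
have ResE l : Res x l = invmx (Delta x) *m rs x 2.
  have /implyP/(_ isT)/eqP := tr0 l (mem_index_enum l).
  have pdl := pd_ResS l x0; move=> /(psd_mxtrace_eq0 (psd_conj _ pdl.1)).
  (* A vanishing square forces [K x l = 0]; multiplying by Delta on the right leaves R_l = Q,
     independent of l. *)
  move=> /(pd_conj_eq0 pdl) /(congr1 (fun M => M *m Delta x)).
  rewrite mulmxKV ?(pd_resolvent_sum1 x0).2 // mul0mx.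
  by move/eqP; rewrite subr_eq0 => /eqP.
apply: Sij; have /(congr1 invmx) : Res x i = Res x j by rewrite !ResE.
by rewrite !invmxK => /addIr.
Qed.

End ResolventSum.

(** * The averaging iteration and its limit *)

Section Averaging.
Variables (R : realType) (k p : nat) (nn : 'I_k -> nat).
Variables (X : 'M[R]_(\sum_i nn i, p)) (rho : 'I_k -> R).
Hypothesis k_gt0 : (0 < k)%N.
Hypothesis p_gt0 : (0 < p)%N.
Hypothesis adm : admissible X rho.
Hypothesis pd_gram : exists i, pd (gram X i).

Let G i := reg_gram X rho i.
Let c i : R := (nn i)%:R * rho i.
Let W := weight_mx X rho.
Let M := contraction_mx X rho.

Let k_neq0 : k%:R != 0 :> R.
Proof. by rewrite pnatr_eq0 -lt0n. Qed.

Lemma psd_gram i : psd (gram X i).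
Proof. exact: psd_trmx_mul. Qed.

Let c_ge0 i : 0 <= c i.
Proof. by rewrite mulr_ge0 ?ler0n //; case: (adm i). Qed.

Let unitG i : G i \in unitmx.
Proof. by case: (adm i). Qed.

Lemma pd_weight_mx : pd W.
Proof.
have [i pi] := pd_gram; apply: (pd_sum (j := i)) => [j|].
  by apply: psd_resolvent_mul (psd_gram j) (c_ge0 j) (unitG j).
exact: (pd_resolvent_mul pi (c_ge0 i)).
Qed.

Let uW := pd_weight_mx.2.

(** Each summand is [c i *: invmx (G i)], that is, I - G_i^-1 X_i^T X_i, since [G i] is the Gram
    matrix plus [c i] times the identity. *)
Lemma contraction_mxE : M = 1%:M - k%:R^-1 *: W.
Proof.
rewrite /M /W /contraction_mx /weight_mx; apply/eqP.
rewrite eq_sym subr_eq -scalerDr -big_split /=; apply/eqP.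
under eq_bigr => i _.
  rewrite -mul_mx_scalar -mulmxDr [_%:M + _]addrC mulVmx //; over.
by rewrite sumr_const card_ord -[1%:M *+ _]scaler_nat scalerA mulVf // scale1r.
Qed.

Lemma psd_contraction_mx : psd M.
Proof.
apply: psdZ; first by rewrite invr_ge0 ler0n.
apply: psd_sum => i; apply: psdZ; first exact: c_ge0.
apply: psd_inv (unitG i).
by apply: psdD; [exact: psd_gram | apply: psd_scalar; exact: c_ge0].
Qed.

Lemma lambda_max_contraction_mx : 0 <= lambda_max M < 1.
Proof.
rewrite lambda_max_ge0 //; last exact: psd_contraction_mx.
apply: lambda_max_lt1 => //; first exact: psd_contraction_mx.
rewrite contraction_mxE opprB addrC subrK; apply: pdZ; last exact: pd_weight_mx.
by rewrite invr_gt0 ltr0n.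
Qed.

(** One step is the affine map sending b to W b_* / k + M b, where b_* is the limit; b_* is its
    fixed point because M = I - W / k. *)
Lemma beta_iter_sub Y t :
  beta_iter X Y rho t.+1 - beta_star X rho Y =
  M *m (beta_iter X Y rho t - beta_star X rho Y).
Proof.
set b := beta_star X rho Y.
have -> : beta_iter X Y rho t.+1 =
    k%:R^-1 *: (W *m b) + M *m beta_iter X Y rho t.
  rewrite /= /b /beta_star mulKVmx // /M /contraction_mx -scalemxAl -scalerDr.
  congr (_ *: _); rewrite mulmx_suml -big_split; apply: eq_bigr => i _.
  by rewrite /local_update mulmxDr -scalemxAr -scalemxAl.
rewrite mulmxBr [X in _ = _ - X *m b]contraction_mxE mulmxBl mul1mx.
by rewrite -[(_ *: W) *m b]scalemxAl opprB addrA [X in X - b]addrC.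
Qed.

Lemma beta_iter_norm_le Y t :
  norm2 (beta_iter X Y rho t - beta_star X rho Y) <=
  lambda_max M ^+ t * norm2 (beta_star X rho Y).
Proof.
elim: t => [|t IH].
  (* The iteration starts at 0, so the initial error is the opposite of the limit. *)
  rewrite expr0 mul1r /= sub0r /norm2.
  by under eq_bigr do rewrite mxE sqrrN.
rewrite beta_iter_sub; apply: le_trans (norm2_mulmx_le _ _ _) _ => //.
  exact: psd_contraction_mx.
rewrite exprS -mulrA ler_wpM2l //.
by have /andP[] := lambda_max_contraction_mx.
Qed.

Lemma beta_iter_cvg Y :
  beta_iter X Y rho t @[t --> \oo] --> beta_star X rho Y.
Proof.
apply/cvg_mxP => i j; rewrite ord1; apply/subr_cvg0/norm_cvg0P.
have /andP[l0 l1] := lambda_max_contraction_mx.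
apply: (@squeeze_cvgr _ _ _ _ (cst 0)
  (fun t => lambda_max M ^+ t * norm2 (beta_star X rho Y))); last 2 first.
- exact: cvg_cst.
- rewrite -(mul0r (norm2 (beta_star X rho Y))); apply: cvgMr_tmp.
  by apply: cvg_expr; rewrite ger0_norm.
apply: nearW => t; rewrite normr_ge0 /=.
apply: le_trans (beta_iter_norm_le Y t).
rewrite -sqrtr_sqr; apply: ler_wsqrtr; rewrite (bigD1 i) //= !mxE lerDl.
by apply: sumr_ge0 => l _; exact: sqr_ge0.
Qed.

(** This is the matrix H through which the estimator depends linearly on the data, as a block row
    matching the partition of Y. *)
Definition star_gain : 'M[R]_(p, \sum_i nn i) :=
  \mxrow_i (invmx W *m invmx (G i) *m (submxcol X i)^T).

Lemma beta_star_gain Y : beta_star X rho Y = star_gain *m Y.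
Proof.
rewrite -[in RHS](submxcolK Y) mul_mxrow_mxcol /beta_star mulmx_sumr.
by apply: eq_bigr => i _; rewrite /xty !mulmxA.
Qed.

(** Being a left inverse of X is what makes the estimator unbiased. *)
Lemma star_gain_mul : star_gain *m X = 1%:M.
Proof.
rewrite -[in LHS](submxcolK X) mul_mxrow_mxcol.
under eq_bigr do rewrite -!mulmxA.
by rewrite -mulmx_sumr mulVmx.
Qed.

(** The i-th block contributes the trace of W^-1 G_i^-1 X_i^T X_i G_i^-1 W^-1; cyclicity and the
    commutation of G_i^-1 with X_i^T X_i group the squares. *)
Lemma star_gain_mxtrace : \tr (star_gain *m star_gain^T) =
  \sum_(i < k) \tr (invmx W ^+ 2 *m invmx (G i) ^+ 2 *m gram X i).
Proof.
have symW : (invmx W)^T = invmx W by rewrite trmx_inv pd_weight_mx.1.1.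
have symG i : (invmx (G i))^T = invmx (G i).
  by rewrite trmx_inv linearD /= tr_scalar_mx (psd_gram i).1.
rewrite tr_mxrow mul_mxrow_mxcol raddf_sum /=; apply: eq_bigr => i _.
have GC : invmx (G i) *m gram X i = gram X i *m invmx (G i).
  by apply: resolvent_comm; exact: unitG.
rewrite !trmx_mul trmxK symW symG !expr2 -!mulmxE.
rewrite -!mulmxA mxtrace_mulC.
transitivity (\tr (invmx (G i) *m (gram X i *m invmx (G i)) *m
    (invmx W *m invmx W))); first by rewrite /gram !mulmxA.
by rewrite -GC mxtrace_mulC !mulmxA.
Qed.

Context (d : measure_display) (T : measurableType d) (P : probability T R).
Variables (beta : 'cV[R]_p) (eps : 'I_(\sum_i nn i) -> {RV P >-> R}).
Variables (sigma : R).
Hypothesis noise : white_noise eps sigma.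

Lemma beta_star_observation w :
  beta_star X rho (observation X beta eps w) =
  beta + star_gain *m \col_j eps j w.
Proof.
by rewrite beta_star_gain /observation mulmxDr mulmxA star_gain_mul mul1mx.
Qed.

Lemma expectation_beta_star j :
  ('E_P[fun w => beta_star X rho (observation X beta eps w) j 0%R] =
   (beta j 0%R)%:E)%E.
Proof.
rewrite -[RHS](expectation_affine noise _ (star_gain j)); congr expectation.
apply/funext => w; rewrite beta_star_observation !mxE; congr (_ + _).
by apply: eq_bigr => l _; congr (_ * _); rewrite mxE.
Qed.

Lemma mse_beta_star :
  mse P (fun w => beta_star X rho (observation X beta eps w)) beta =
  (sigma ^+ 2 *
   \sum_(i < k) \tr (invmx W ^+ 2 *m invmx (G i) ^+ 2 *m gram X i))%:E.
Proof.
rewrite -star_gain_mxtrace; apply: (mse_linear noise) => w.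
by rewrite beta_star_observation addrAC subrr add0r.
Qed.

End Averaging.

(** * The balanced case *)

Section DeriveWithin.
Variable R : realType.
Implicit Types (f g : R -> R) (x a : R).

(** Lets a function that is controlled only on [D] inherit the two-sided derivative of a closed
    form, even at an endpoint of [D]. *)
Lemma cvg_diff_quot_within (D : set R) f g x a :
  (forall y, D y -> f y = g y) -> D x -> diff_quot g x @ x^' --> a ->
  diff_quot f x @ within D x^' --> a.
Proof.
move=> fg Dx ga; apply: cvg_trans (cvg_within_filter _ ga).
apply: near_eq_cvg; apply: filterS (withinT D _) => y Dy.
by rewrite /diff_quot !fg.
Qed.

Lemma within_itvcy_proper_filter x : 0 <= x ->
  ProperFilter (within `[0, +oo[ x^').
Proof.
move=> x0; apply: Build_ProperFilter => -[e e0 xe].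
(* A point to the right of x stays in the half-line, also when x = 0. *)
apply: (xe (x + e / 2)) => /=.
- rewrite opprD addrA subrr sub0r normrN gtr0_norm ?divr_gt0 //.
  by rewrite gtr_pMr // invf_lt1 // ltr1n.
- by rewrite -subr_eq0 addrAC subrr add0r gt_eqF // divr_gt0.
- by rewrite in_itv /= andbT addr_ge0 // ltW // divr_gt0.
Qed.

End DeriveWithin.

Section Balanced.
Variables (R : realType) (k p : nat) (nn : 'I_k -> nat).
Variables (X : 'M[R]_(\sum_i nn i, p)).
Hypothesis k_gt0 : (0 < k)%N.
Hypothesis p_gt0 : (0 < p)%N.
Hypothesis unit_gram : forall i, gram X i \in unitmx.

Lemma pd_gram i : pd (gram X i).
Proof. by split=> //; exact: psd_gram. Qed.

Lemma mulmx_tr_sum_gram : X^T *m X = \sum_i gram X i.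
Proof.
by rewrite -{1 2}(submxcolK X) tr_mxcol mul_mxrow_mxcol.
Qed.

Lemma mulmx_tr_sum_xty Y : X^T *m Y = \sum_i xty X Y i.
Proof.
by rewrite -{1}(submxcolK X) -{1}(submxcolK Y) tr_mxcol mul_mxrow_mxcol.
Qed.

Lemma pd_mulmx_tr : pd (X^T *m X).
Proof.
rewrite mulmx_tr_sum_gram; apply: (pd_sum (j := Ordinal k_gt0)) => [i|].
  exact: psd_gram.
exact: pd_gram.
Qed.

(** An invertible Gram matrix has rank p, which is at most the number of rows of the block. *)
Lemma rows_gt0 i : (0 < nn i)%N.
Proof.
apply: leq_trans p_gt0 _; rewrite -[p in (p <= _)%N](mxrank_unit (unit_gram i)).
exact: mulmx_max_rank.
Qed.

Lemma admissible_cst x : 0 <= x -> admissible X (fun=> x).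
Proof.
move=> x0 i; split=> //; apply: (pdDl (pd_gram i) _).2.
by apply: psd_scalar; rewrite mulr_ge0 ?ler0n.
Qed.

Lemma reg_gram0 i : reg_gram X (fun=> 0) i = gram X i.
Proof. by rewrite /reg_gram mulr0 raddf0 addr0. Qed.

Lemma weight_mx0 : weight_mx X (fun=> 0) = k%:R%:M.
Proof.
rewrite /weight_mx; under eq_bigr do rewrite reg_gram0 mulVmx //.
by rewrite sumr_const card_ord -raddfMn.
Qed.

Lemma beta_star0 Y : beta_star X (fun=> 0) Y = one_step X Y.
Proof.
rewrite /beta_star weight_mx0 invmx_scalar mul_scalar_mx.
by under eq_bigr do rewrite reg_gram0.
Qed.

Let N : R := (\sum_i nn i)%:R / k%:R.
Hypothesis balanced : forall i, (nn i)%:R = N.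

Let N_gt0 : 0 < N.
Proof. by rewrite -(balanced (Ordinal k_gt0)) ltr0n rows_gt0. Qed.

Let N_neq0 : N != 0.
Proof. by rewrite gt_eqF. Qed.

Let S i := hat_Sigma X i.
Let Res y i : 'M[R]_p := invmx (S i + y%:M).

Lemma hat_SigmaE i : hat_Sigma X i = N^-1 *: gram X i.
Proof. by rewrite /hat_Sigma balanced. Qed.

Lemma pd_hat_Sigma i : pd (hat_Sigma X i).
Proof.
by rewrite hat_SigmaE; apply: pdZ; [rewrite invr_gt0 | exact: pd_gram].
Qed.

Let gramE i : gram X i = N *: S i.
Proof. by rewrite /S hat_SigmaE scalerA divff // scale1r. Qed.

Let invmx_reg_gram x i : 0 <= x ->
  invmx (reg_gram X (fun=> x) i) = N^-1 *: Res x i.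
Proof.
move=> x0; have GE : reg_gram X (fun=> x) i = N *: (S i + x%:M).
  rewrite /reg_gram gramE balanced scalerDr; congr (_ + _).
  by rewrite scale_scalar_mx.
by rewrite GE invmxZ // -GE; exact: (admissible_cst x0 i).2.
Qed.

Lemma weight_mx_cst x : 0 <= x ->
  weight_mx X (fun=> x) = resolvent_sum X x 1.
Proof.
move=> x0; apply: eq_bigr => i _; rewrite invmx_reg_gram // gramE expr1.
by rewrite -scalemxAl -scalemxAr scalerA mulVf // scale1r.
Qed.

(** The regularized Gram matrix is N (S_i + x I) and the Gram matrix is N S_i, so the powers of N
    combine to N^-1. *)
Lemma star_trace_cst x : 0 <= x ->
  \sum_(i < k) \tr (invmx (weight_mx X (fun=> x)) ^+ 2 *m
                    invmx (reg_gram X (fun=> x) i) ^+ 2 *m gram X i) =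
  N^-1 * \tr (invmx (resolvent_sum X x 1) ^+ 2 *m resolvent_sum X x 2).
Proof.
move=> x0; rewrite weight_mx_cst // mulmx_sumr raddf_sum mulr_sumr.
apply: eq_bigr => i _; rewrite invmx_reg_gram // gramE -mulmxA.
rewrite [X in _ * X](_ : _ = \tr (invmx (resolvent_sum X x 1) ^+ 2 *m
  (Res x i ^+ 2 *m S i))) // -mxtraceZ scalemxAr; congr (\tr (_ *m _)).
rewrite !expr2 -!mulmxE -!scalemxAl -!scalemxAr -!scalemxAl !scalerA.
by congr (_ *: _); rewrite balanced; move: N_neq0; move: N => r r0; field.
Qed.

Lemma sum_hat_Sigma : \sum_i S i = N^-1 *: (X^T *m X).
Proof.
rewrite mulmx_tr_sum_gram scaler_sumr.
by apply: eq_bigr => i _; exact: hat_SigmaE.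
Qed.

(** For y > 0, y R_i is the inverse of y^-1 S_i + I, which tends to I. *)
Let cvg_Res i : y *: Res y i @[y --> +oo] --> (1%:M : 'M[R]_p).
Proof.
have invy : y^-1 @[y --> +oo%R] --> (0 : R).
  have y0 : \forall y \near +oo%R, 0 < (y : R).
    by apply: nbhs_pinfty_gt; exact: num_real.
  exact: (gtr0_cvgV0 (f := id) y0).2 cvg_id.
have H : y^-1 *: S i + 1%:M @[y --> +oo%R] --> (1%:M : 'M[R]_p).
  rewrite -[X in _ --> X]add0r -(scale0r (S i)).
  by apply: cvgD; [apply: cvgZr_tmp | exact: cvg_cst].
rewrite -[X in _ --> X]invmx1.
apply: cvg_trans (cvg_invmx (unitmx1 _ _) H); apply: near_eq_cvg.
have : \forall y \near +oo%R, 0 < (y : R).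
  by apply: nbhs_pinfty_gt; exact: num_real.
apply: filterS => y y0; have yu : y^-1 *: (S i + y%:M) \in unitmx.
  rewrite unitmxZ ?unitfE ?invr_eq0 ?gt_eqF //.
  by apply: (pdDl (pd_hat_Sigma i) _).2; apply: psd_scalar; exact: ltW.
have -> : y^-1 *: S i + 1%:M = y^-1 *: (S i + y%:M).
  by rewrite scalerDr scale_scalar_mx mulVf // gt_eqF.
by rewrite invmxZ // invrK.
Qed.

Let cvg_Delta :
  y *: resolvent_sum X y 1 @[y --> +oo] --> \sum_i S i.
Proof.
under eq_cvg do rewrite scaler_sumr.
apply: cvg_mxsum => i; rewrite -[X in _ --> X]mul1mx.
under eq_cvg do rewrite scalemxAl expr1.
exact: cvg_mulmx (cvg_Res i) (cvg_cst _).
Qed.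

Let cvg_rs2 :
  y ^+ 2 *: resolvent_sum X y 2 @[y --> +oo] --> \sum_i S i.
Proof.
under eq_cvg do rewrite scaler_sumr.
apply: cvg_mxsum => i; rewrite -[X in _ --> X]mul1mx -[X in X *m _]mul1mx.
under eq_cvg do rewrite scalemxAl !expr2 -mulmxE -scalerA scalemxAr scalemxAl.
by apply: cvg_mulmx (cvg_cst _); apply: cvg_mulmx; exact: cvg_Res.
Qed.

Let unit_sum_S : \sum_i S i \in unitmx.
Proof.
apply: (pd_sum (j := Ordinal k_gt0) _ _).2 => [i|]; last exact: pd_hat_Sigma.
exact: (pd_hat_Sigma i).1.
Qed.

Let unit_Delta y : 0 <= y -> resolvent_sum X y 1 \in unitmx.
Proof. by move=> y0; exact: (pd_resolvent_sum1 k_gt0 pd_hat_Sigma y0).2. Qed.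

(** Neither factor has a useful limit alone, but Delta^-2 B = (y Delta)^-2 (y^2 B), where both y
    Delta and y^2 B tend to the sum of the S_i. *)
Lemma cvg_resolvent_trace :
  \tr (invmx (resolvent_sum X y 1) ^+ 2 *m resolvent_sum X y 2)
    @[y --> +oo] --> N * \tr (invmx (X^T *m X)).
Proof.
have -> : N * \tr (invmx (X^T *m X)) =
    \tr (invmx (\sum_i S i) *m invmx (\sum_i S i) *m \sum_i S i).
  rewrite -mulmxA mulVmx // mulmx1 sum_hat_Sigma invmxZ ?invrK ?mxtraceZ //.
  by rewrite -sum_hat_Sigma.
have cD : invmx (y *: resolvent_sum X y 1) @[y --> +oo] --> invmx (\sum_i S i).
  exact: cvg_invmx unit_sum_S cvg_Delta.
have cDDB : invmx (y *: resolvent_sum X y 1) *m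
    invmx (y *: resolvent_sum X y 1) *m (y ^+ 2 *: resolvent_sum X y 2)
    @[y --> +oo] --> invmx (\sum_i S i) *m invmx (\sum_i S i) *m \sum_i S i.
  by apply: cvg_mulmx cvg_rs2; apply: cvg_mulmx.
apply: cvg_trans (cvg_mxtrace cDDB); apply: near_eq_cvg.
have : \forall y \near +oo%R, 0 < (y : R).
  by apply: nbhs_pinfty_gt; exact: num_real.
apply: filterS => y y0; have yn0 : y != 0 by rewrite gt_eqF.
rewrite invmxZ; last by rewrite unitmxZ ?unitfE ?unit_Delta ?ltW.
set D := invmx (resolvent_sum X y 1).
have -> : D ^+ 2 = D *m D by rewrite expr2.
rewrite -!scalemxAl -!scalemxAr -!scalemxAl !scalerA.
by rewrite [X in X *: _](_ : _ = 1) ?scale1r //; field.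
Qed.

(** The same rescaling applies: a factor y inserted in Delta is compensated by one in front of each
    R_i. *)
Lemma cvg_beta_star_ols Y :
  beta_star X (fun=> y) Y @[y --> +oo] --> ols X Y.
Proof.
have -> : ols X Y =
    invmx (\sum_i S i) *m \sum_i (N^-1 *: (1%:M *m xty X Y i)).
  rewrite sum_hat_Sigma invmxZ -?sum_hat_Sigma // invrK -scaler_sumr.
  rewrite -scalemxAl -scalemxAr scalerA divff // scale1r /ols mulmx_tr_sum_xty.
  by congr (_ *m _); apply: eq_bigr => i _; rewrite mul1mx.
have cv : \sum_i (N^-1 *: (y *: Res y i *m xty X Y i)) @[y --> +oo] -->
    \sum_i (N^-1 *: (1%:M *m xty X Y i)).
  apply: cvg_mxsum => i; apply: cvgZl_tmp.
  exact: cvg_mulmx (cvg_Res i) (cvg_cst _).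
have cb : invmx (y *: resolvent_sum X y 1) *m
    \sum_i (N^-1 *: (y *: Res y i *m xty X Y i)) @[y --> +oo] -->
    invmx (\sum_i S i) *m \sum_i (N^-1 *: (1%:M *m xty X Y i)).
  by apply: cvg_mulmx cv; exact: cvg_invmx unit_sum_S cvg_Delta.
apply: cvg_trans cb; apply: near_eq_cvg.
have : \forall y \near +oo%R, 0 < (y : R).
  by apply: nbhs_pinfty_gt; exact: num_real.
apply: filterS => y y0; have yn0 : y != 0 by rewrite gt_eqF.
rewrite invmxZ; last by rewrite unitmxZ ?unitfE ?unit_Delta ?ltW.
rewrite /beta_star weight_mx_cst ?ltW // -scalemxAl scalemxAr scaler_sumr.
congr (_ *m _); apply: eq_bigr => i _.
rewrite invmx_reg_gram ?ltW // -!scalemxAl !scalerA.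
by congr (_ *: _); move: N_neq0; move: N => r r0; field; rewrite r0 yn0.
Qed.

End Balanced.

(** * The mean squared error as a function of the regularization parameter *)

Section BalancedMSE.
Context (d : measure_display) (T : measurableType d) (R : realType).
Context (P : probability T R).
Variables (k p : nat) (nn : 'I_k -> nat) (X : 'M[R]_(\sum_i nn i, p)).
Variables (beta : 'cV[R]_p) (eps : 'I_(\sum_i nn i) -> {RV P >-> R}).
Variable sigma : R.
Hypothesis k_gt0 : (0 < k)%N.
Hypothesis p_gt0 : (0 < p)%N.
Hypothesis noise : white_noise eps sigma.
Hypothesis unit_gram : forall i, gram X i \in unitmx.

Let n := (\sum_i nn i)%N.
Let Y := observation X beta eps.

Let ex_pd_gram : exists i, pd (gram X i).
Proof. by exists (Ordinal k_gt0); exact: pd_gram. Qed.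

(** The error is finite, so [fine] in [psi] loses nothing. *)
Lemma mse_psi x : 0 <= x ->
  mse P (fun w => beta_star X (fun=> x) (Y w)) beta = (psi X beta eps x)%:E.
Proof.
move=> x0; rewrite /psi fineK //.
by rewrite (mse_beta_star (admissible_cst unit_gram x0) ex_pd_gram beta noise).
Qed.

Lemma psi0 : psi X beta eps 0 =
  sigma ^+ 2 / k%:R ^+ 2 * \sum_(i < k) \tr (invmx (gram X i)).
Proof.
have adm := admissible_cst unit_gram (lexx 0).
rewrite /psi (mse_beta_star adm ex_pd_gram beta noise) /= -mulrA; congr (_ * _).
rewrite mulr_sumr; apply: eq_bigr => i _.
rewrite weight_mx0 // invmx_scalar reg_gram0 expr2 -mulmxE mul_scalar_mx.
rewrite scale_scalar_mx -mulmxA mul_scalar_mx mxtraceZ -expr2 exprVn.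
by rewrite [_ (gram X i) ^+ 2]expr2 -mulmxE -mulmxA mulVmx // mulmx1.
Qed.

Lemma mse_ols :
  mse P (fun w => ols X (Y w)) beta =
  (sigma ^+ 2 * \tr (invmx (X^T *m X)))%:E.
Proof.
have [[symX _] uX] := pd_mulmx_tr k_gt0 unit_gram.
rewrite (mse_linear noise (A := invmx (X^T *m X) *m X^T)) => [|w].
  rewrite trmx_mul trmxK trmx_inv symX -mulmxA [X^T *m (_ *m _)]mulmxA.
  by rewrite mulmxV // mulmx1.
rewrite /ols /Y /observation mulmxDr mulmxDr !mulmxA.
by rewrite -[_ *m X^T *m X]mulmxA mulVmx // mul1mx addrAC subrr add0r.
Qed.

Hypothesis balanced : forall i, (nn i)%:R = n%:R / k%:R :> R.

Lemma psiE x : 0 <= x ->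
  psi X beta eps x = k%:R * sigma ^+ 2 / n%:R *
    \tr (invmx (resolvent_sum X x 1) ^+ 2 *m resolvent_sum X x 2).
Proof.
move=> x0; have adm := admissible_cst unit_gram x0.
rewrite /psi (mse_beta_star adm ex_pd_gram beta noise) /=.
rewrite (star_trace_cst k_gt0 p_gt0 unit_gram balanced x0) mulrA invf_div.
by congr (_ * _); rewrite mulrCA mulrA.
Qed.

Let c0 : R := k%:R * sigma ^+ 2 / n%:R.
(** The closed form of [psi] on the half-line. It is differentiable in the two-sided sense at every
    x >= 0, including 0, and carries the calculus. *)
Let g x := c0 * \tr (invmx (resolvent_sum X x 1) ^+ 2 *m resolvent_sum X x 2).
Let dg x := 2 * c0 *
  \tr (invmx (resolvent_sum X x 1) *m resolvent_sum X x 2 *m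
       invmx (resolvent_sum X x 1) ^+ 2 *m resolvent_sum X x 2 -
       invmx (resolvent_sum X x 1) ^+ 2 *m resolvent_sum X x 3).

Let pdS := pd_hat_Sigma k_gt0 p_gt0 unit_gram balanced.

Let diff_quot_g x : 0 <= x -> diff_quot g x @ x^' --> dg x.
Proof.
by move=> x0; exact: (diff_quot_resolvent_trace k_gt0 pdS).
Qed.

Lemma cvg_diff_quot_psi x : 0 <= x ->
  diff_quot (psi X beta eps) x @ within `[0, +oo[ x^' --> dg x.
Proof.
move=> x0; apply: (cvg_diff_quot_within (g := g)) (diff_quot_g x0) => [y|].
  by rewrite /= in_itv /= andbT => /psiE.
by rewrite /= in_itv /= andbT.
Qed.

Lemma derive_within_psi x : 0 <= x ->
  derivable_within `[0, +oo[ (psi X beta eps) x /\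
  derive_within `[0, +oo[ (psi X beta eps) x = dg x.
Proof.
move=> x0; have cv := cvg_diff_quot_psi x0.
split; first by apply/cvg_ex; exists (dg x).
have PF := within_itvcy_proper_filter x0.
exact: cvg_lim cv.
Qed.

Let n_gt0 : 0 < n%:R :> R.
Proof.
rewrite ltr0n lt0n; apply/negP => /eqP n0; move: (balanced (Ordinal k_gt0)).
rewrite n0 mul0r => /eqP; rewrite pnatr_eq0 => /eqP nn0.
by have := rows_gt0 p_gt0 unit_gram (Ordinal k_gt0); rewrite nn0.
Qed.

Let derivable_g x : 0 <= x -> derivable g x 1.
Proof. by move=> x0; have [] := is_derive_diff_quot (diff_quot_g x0). Qed.

Let derive1_g x : 0 <= x -> derive1 g x = dg x.
Proof.
by move=> x0; rewrite derive1E; have [] := is_derive_diff_quot (diff_quot_g x0).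
Qed.

Let continuous_g a b : 0 <= a -> {within `[a, b], continuous g}.
Proof.
move=> a0; apply: derivable_within_continuous => x.
by rewrite in_itv /= => /andP[ax _]; apply: derivable_g; apply: le_trans ax.
Qed.

Lemma psi_nonincreasing a b : 0 <= a -> a <= b ->
  psi X beta eps b <= psi X beta eps a.
Proof.
move=> a0 ab; rewrite !psiE ?(le_trans a0) // -/(g a) -/(g b).
have pos x : x \in `]a, b[ -> 0 <= x.
  by rewrite in_itv /= => /andP[/ltW ax _]; apply: le_trans ax.
apply: (@ler0_derive1_nincr _ g a b) => //.
- by move=> x /pos; exact: derivable_g.
- move=> x /pos x0; rewrite derive1_g // mulr_ge0_le0 //.
    by apply: mulr_ge0 => //; rewrite divr_ge0 ?ler0n // mulr_ge0 ?sqr_ge0.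
  exact: (resolvent_trace_le0 k_gt0 pdS).
- exact: continuous_g.
Qed.

Hypothesis sigma_gt0 : 0 < sigma.
Hypothesis gram_neq : exists i j, gram X i <> gram X j.

Let dg_lt0 x : 0 <= x -> dg x < 0.
Proof.
move=> x0; have [i [j ij]] := gram_neq.
rewrite nmulr_llt0; last first.
  apply: (resolvent_trace_lt0 k_gt0 pdS (i := i) (j := j)) => //.
  (* Multiplying by the common block size turns equality of the normalized matrices into equality of
     the Gram matrices. *)
  rewrite !(hat_SigmaE _ balanced) => /(congr1 ( *:%R (n%:R / k%:R))).
  have Nn0 : n%:R / k%:R != 0 :> R.
    by rewrite mulf_neq0 ?invr_eq0 ?gt_eqF // ltr0n.
  by rewrite !scalerA divff // !scale1r.
by rewrite mulr_gt0 // /c0 divr_gt0 // mulr_gt0 ?ltr0n ?exprn_gt0.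
Qed.

Lemma derive_within_psi0_lt0 : derive_within `[0, +oo[ (psi X beta eps) 0 < 0.
Proof. by rewrite (derive_within_psi (lexx 0)).2 dg_lt0. Qed.

Lemma psi_lt_psi0 x : 0 < x -> psi X beta eps x < psi X beta eps 0.
Proof.
move=> x0; rewrite (psiE (ltW x0)) (psiE (lexx 0)) -/(g x) -/(g 0).
have pos y : y \in `]0, x[ -> 0 <= y by rewrite in_itv /= => /andP[/ltW].
apply: (@ltr0_derive1_decr _ g 0 x) => //.
- by move=> y /pos; exact: derivable_g.
- by move=> y /pos y0; rewrite derive1_g // dg_lt0.
- exact: continuous_g.
Qed.

End BalancedMSE.

Theorem theorem7p2 (d : measure_display) (T : measurableType d) (R : realType)
    (P : probability T R) (k p : nat) (k_gt0 : (0 < k)%N) (p_gt0 : (0 < p)%N)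
    (nn : 'I_k -> nat) (X : 'M[R]_(\sum_i nn i, p)) (beta : 'cV[R]_p)
    (eps : 'I_(\sum_i nn i) -> {RV P >-> R}) (sigma : R) (sigma_gt0 : 0 < sigma)
    (noise : white_noise eps sigma) :
  let n := (\sum_i nn i)%N in
  let Y := observation X beta eps in
  (forall rho : 'I_k -> R, admissible X rho ->
     (exists i, forall a, eigenvalue (gram X i) a -> 0 < a) ->
     [/\ weight_mx X rho \in unitmx,
         forall w, beta_iter X (Y w) rho t @[t --> \oo]
                     --> beta_star X rho (Y w),
         forall j,
           ('E_P[fun w => beta_star X rho (Y w) j 0%R] = (beta j 0%R)%:E)%E,
         0 <= lambda_max (contraction_mx X rho) < 1 &
         forall w t,
           norm2 (beta_iter X (Y w) rho t - beta_star X rho (Y w)) <=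
           lambda_max (contraction_mx X rho) ^+ t *
           norm2 (beta_star X rho (Y w))]
     /\
     mse P (fun w => beta_star X rho (Y w)) beta =
       (sigma ^+ 2 *
        \sum_(i < k) \tr (invmx (weight_mx X rho) ^+ 2 *m
                          invmx (reg_gram X rho i) ^+ 2 *m gram X i))%:E)
  /\
  ((forall i, gram X i \in unitmx) ->
   (forall i, (nn i)%:R = n%:R / k%:R :> R) ->
   let psi := psi X beta eps in
   let psi' := derive_within `[0, +oo[ psi in
   let Delta rho := resolvent_sum X rho 1 in
   [/\ forall rho, 0 <= rho ->
         derivable_within `[0, +oo[ psi rho /\
         psi' rho = 2 * k%:R * sigma ^+ 2 / n%:R *
           \tr (invmx (Delta rho) *m resolvent_sum X rho 2 *m
                invmx (Delta rho) ^+ 2 *m resolvent_sum X rho 2 -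
                invmx (Delta rho) ^+ 2 *m resolvent_sum X rho 3),
       forall a b, 0 <= a -> a <= b -> psi b <= psi a,
       (exists i j, gram X i <> gram X j) ->
         [/\ psi' 0 < 0,
             forall rho, 0 < rho -> psi rho < psi 0 &
             forall rho, 0 < rho ->
               (mse P (fun w => beta_star X (fun=> rho) (Y w)) beta <
                mse P (fun w => one_step X (Y w)) beta)%E],
       [/\ forall w, beta_star X (fun=> 0) (Y w) = one_step X (Y w),
           mse P (fun w => one_step X (Y w)) beta = (psi 0)%:E &
           psi 0 = sigma ^+ 2 / k%:R ^+ 2 *
                   \sum_(i < k) \tr (invmx (gram X i))] &
       [/\ X^T *m X \in unitmx,
           forall w, beta_star X (fun=> rho) (Y w) @[rho --> +oo]
                       --> ols X (Y w),
           mse P (fun w => ols X (Y w)) beta =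
             (sigma ^+ 2 * \tr (invmx (X^T *m X)))%:E &
           psi rho @[rho --> +oo] --> sigma ^+ 2 * \tr (invmx (X^T *m X))]]).
Proof.
move=> n Y; split=> [rho adm [i eig_gt0]|unit_gram balanced psi psi' Delta].
  have pdX : exists i, pd (gram X i).
    exists i; split; first exact: psd_gram.
    (* A singular Gram matrix would have the eigenvalue 0, against strict positivity of its
       spectrum. *)
    apply/negPn/negP => not_unit; have := eig_gt0 0.
    rewrite ltxx => /(_ _)/notF; apply.
    rewrite eigenvalue_notin_unitmx raddf0 sub0r -scaleN1r.
    by rewrite unitmxZ ?unitrN1.
  split; last exact: mse_beta_star.
  split=> [|w|j||w t].
  - exact: (pd_weight_mx adm pdX).2.
  - exact: beta_iter_cvg.
  - exact: expectation_beta_star noise _.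
  - exact: lambda_max_contraction_mx.
  - exact: beta_iter_norm_le.
have star0 w : beta_star X (fun=> 0) (Y w) = one_step X (Y w).
  exact: beta_star0.
have mse0 : mse P (fun w => one_step X (Y w)) beta = (psi 0)%:E.
  rewrite -(mse_psi beta k_gt0 noise unit_gram (lexx 0)).
  by congr mse; apply/funext => w; rewrite star0.
split.
- move=> rho rho0.
  have [dW dE] := derive_within_psi beta k_gt0
    p_gt0 noise unit_gram balanced rho0.
  by split=> //; apply: (etrans dE); rewrite !mulrA.
- by move=> a b; exact: psi_nonincreasing noise unit_gram balanced a b.
- move=> gram_neq.
  have lt0 rho : 0 < rho -> psi rho < psi 0.
    exact: psi_lt_psi0 noise unit_gram balanced sigma_gt0 gram_neq rho.
  split=> // [|rho rho0].
    exact: derive_within_psi0_lt0 noise unit_gram balanced sigma_gt0 gram_neq.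
  rewrite mse0 (mse_psi beta k_gt0 noise unit_gram (ltW rho0)) lte_fin.
  exact: lt0.
- by split=> //; exact: psi0.
- split.
  + exact: (pd_mulmx_tr k_gt0 unit_gram).2.
  + move=> w; exact: cvg_beta_star_ols balanced _.
  + exact: mse_ols.
  + have n_neq0 : n%:R / k%:R != 0 :> R.
      rewrite -(balanced (Ordinal k_gt0)) pnatr_eq0 -lt0n.
      exact: (rows_gt0 p_gt0 unit_gram).
    move: n_neq0; rewrite mulf_eq0 invr_eq0 negb_or => /andP[n0 k0].
    (* The factor n / k of the trace limit cancels the k / n in the closed form of [psi]. *)
    have -> : sigma ^+ 2 * \tr (invmx (X^T *m X)) =
        k%:R * sigma ^+ 2 / n%:R * (n%:R / k%:R * \tr (invmx (X^T *m X))).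
      by field; rewrite k0 n0.
    have cT := cvg_resolvent_trace k_gt0 p_gt0 unit_gram balanced.
    apply: cvg_trans (cvgMl_tmp (a := k%:R * sigma ^+ 2 / n%:R) cT).
    apply: near_eq_cvg.
    have : \forall y \near +oo%R, 0 < (y : R).
      by apply: nbhs_pinfty_gt; exact: num_real.
    apply: filterS => y y0.
    by rewrite /psi (psiE beta k_gt0 p_gt0 noise unit_gram balanced (ltW y0)).
Qed.
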